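(* Let $\{X_i : i\in I\}$ be a countable family of nonempty metric spaces. If the product $X=\prod_{i\in I}X_i$ is straight, then all spaces $X_i$ are straight and one of the following three cases occurs: (a) all $X_i$ are ULC and all but finitely many of the spaces $X_i$ are connected (i.e., $X$ is ULC); (b) all $X_i$ are precompact; (c) all but one of the spaces $X_i$ are both ULC and precompact, and all but finitely many of the spaces $X_i$ are connected.
   Context: All spaces are metric. A metric space $X$ is straight if whenever $X$ is the union of finitely many closed sets, a continuous function $f\colon X\to\mathbb{R}$ is uniformly continuous if and only if its restriction to each of these closed sets is uniformly continuous. A metric space $X$ is uniformly locally connected (ULC) if for every $\varepsilon>0$ there is $\delta>0$ such that any two points of $X$ at distance $<\delta$ lie in a connected subset of $X$ of diameter $<\varepsilon$. Precompact means totally bounded (equivalently, the metric completion is compact). Metrics are assumed to be bounded by $1$ (only uniform properties matter). A finite product of metric spaces $(X_i,d_i)$ carries the metric $d(x,y)=\sum_i d_i(x_i,y_i)$; a countably infinite product, with the factors enumerated as $X_1,X_2,\ldots$, carries the metric $d(x,y)=\sum_n\frac{1}{2^n}d_n(x_n,y_n)$. *)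

(* Defs.v *)
From HB Require Import structures.
From mathcomp Require Import all_boot all_order all_algebra.
From mathcomp Require Import all_classical all_reals all_analysis.

Set Implicit Arguments.
Unset Strict Implicit.
Unset Printing Implicit Defensive.

Import Order.TTheory GRing.Theory Num.Theory.
Import numFieldNormedType.Exports.

Local Open Scope classical_set_scope.
Local Open Scope ring_scope.

Section metric_notions.
Context {R : realType} (X : metricType R).

(* On points of A, the uniformity of [subspace A] is the one induced by X;
   points outside A are uniformly isolated (related only to themselves), so
   only the values of f on A matter. *)
Definition unif_continuous_on (A : set X) (f : X -> R) : Prop :=
  unif_continuous (f : subspace A -> R).

Definition straight : Prop :=
  forall (n : nat) (C : 'I_n -> set X),
    (forall k, closed (C k)) -> \bigcup_k C k = [set: X] ->
    forall f : X -> R, continuous f ->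
      (unif_continuous f <-> forall k, unif_continuous_on (C k) f).

Definition diameter (A : set X) : \bar R :=
  ereal_sup [set (mdist x y)%:E | x in A & y in A].

Definition unif_locally_connected : Prop :=
  forall e : R, 0 < e -> exists2 d : R, 0 < d &
    forall x y : X, mdist x y < d ->
      exists C : set X, [/\ connected C, C x, C y & (diameter C < e%:E)%E].

(* Distinct from the library's [precompact], which means relatively compact. *)
Definition totally_bounded : Prop :=
  forall e : R, 0 < e -> exists2 F : set X, finite_set F &
    [set: X] = \bigcup_(x in F) ball x e.

End metric_notions.

Arguments straight {R} X.
Arguments unif_locally_connected {R} X.
Arguments totally_bounded {R} X.

(* A countable index type together with an enumeration without repetition;
   the empty type is allowed. *)
Variant enumeration (I : Type) : Type :=
| FinEnum (n : nat) (e : 'I_n -> I) of bijective e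
| InfEnum (e : nat -> I) of bijective e.

Section product_metric.
Context {R : realType} {I : Type} (E : enumeration I) (X : I -> metricType R).

(* The sum of 2^-n d_n over n >= 1 with factors X_1, X_2, ...: here the first
   factor is X (e 0), hence the exponent n.+1.  [limn] is meaningful only when
   the series converges, e.g. when the metrics are uniformly bounded. *)
Definition prod_mdist (x y : forall i, X i) : R :=
  match E with
  | FinEnum n e _ => \sum_(k < n) mdist (x (e k)) (y (e k))
  | InfEnum e _ =>
      limn (series (fun n => (2 ^+ n.+1)^-1 * mdist (x (e n)) (y (e n))))
  end.

Hypothesis X_le1 : forall i (x y : X i), mdist x y <= 1.

Let term_cvg (e : nat -> I) (x y : forall i, X i) :
  cvgn (series (fun n => (2 ^+ n.+1)^-1 * mdist (x (e n)) (y (e n)))).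
Proof.
apply: (@series_le_cvg _ _ (geometric 1 (2^-1))) => [n|n|n|].
- by rewrite mulr_ge0 ?mdist_ge0// invr_ge0 exprn_ge0.
- by rewrite /geometric/= mul1r exprn_ge0// invr_ge0.
- rewrite /geometric/= mul1r exprVn.
  apply: (@le_trans _ _ ((2 ^+ n.+1)^-1)).
    by rewrite ler_piMr// invr_ge0 exprn_ge0.
  by rewrite lef_pV2 ?posrE ?exprn_gt0// ler_eXn2l// ltr1n.
- apply: is_cvg_geometric_series.
  by rewrite ger0_norm ?invr_ge0// invf_lt1// ltr1n.
Qed.

Lemma prod_mdistxx x : prod_mdist x x = 0.
Proof.
rewrite /prod_mdist; case: E => [n e _|e _].
  by rewrite big1// => k _; rewrite mdistxx.
have -> : (fun n => (2 ^+ n.+1)^-1 * mdist (x (e n)) (x (e n))) = fun=> 0 :> R.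
  by apply/funext => n; rewrite mdistxx mulr0.
have -> : series (fun=> 0 : R) = fun=> 0 :> R.
  by apply/funext => n; rewrite /series/= big1.
exact: lim_cst.
Qed.

Lemma prod_mdist_positivity x y : prod_mdist x y = 0 -> x = y.
Proof.
move=> d0; apply: functional_extensionality_dep => i.
move: d0; rewrite /prod_mdist; case: E => [n e|e] [g ge eg].
  move/eqP; rewrite psumr_eq0; last by move=> k _; exact: mdist_ge0.
  move=> /allP/(_ (g i)); rewrite mem_index_enum => /(_ isT)/=.
  by rewrite eg => /eqP/mdist_positivity.
move=> d0; apply: mdist_positivity; apply/eqP.
rewrite eq_le mdist_ge0 andbT.
set u := fun n => (2 ^+ n.+1)^-1 * mdist (x (e n)) (y (e n)) in d0.
have u0 n : 0 <= u n by rewrite mulr_ge0 ?mdist_ge0// invr_ge0 exprn_ge0.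
have ui : nondecreasing_seq (series u).
  by apply: nondecreasing_series => n _ _; exact: u0.
have := nondecreasing_cvgn_le ui (@term_cvg e x y) (g i).+1.
rewrite d0 /series/= big_nat_recr//= => H.
have : u (g i) <= 0.
  by apply: le_trans H; rewrite lerDr sumr_ge0.
by rewrite /u eg pmulr_rle0// invr_gt0 exprn_gt0.
Qed.

Lemma prod_mdist_sym x y : prod_mdist x y = prod_mdist y x.
Proof.
rewrite /prod_mdist; case: E => [n e _|e _].
  by apply: eq_bigr => k _; exact: metric_sym.
by congr (limn (series _)); apply/funext => n; rewrite metric_sym.
Qed.

Lemma prod_mdist_triangle y x z :
  prod_mdist x z <= prod_mdist x y + prod_mdist y z.
Proof.
rewrite /prod_mdist; case: E => [n e _|e _].
  by rewrite -big_split/= ler_sum// => k _; exact: metric_triangle.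
rewrite -lim_seriesD; [|exact: term_cvg|exact: term_cvg].
apply: lim_series_le; [exact: term_cvg| |].
  by apply: is_cvg_seriesD; exact: term_cvg.
move=> n; rewrite fctE -mulrDr ler_wpM2l ?metric_triangle// invr_ge0 exprn_ge0.
Qed.

(* An alias of the product type, kept apart from the library's
   [prod_topology]; the proof argument is what makes it a metric space. *)
Definition metric_prod
    of (forall i (x y : X i), mdist x y <= 1) & enumeration I : Type :=
  forall i, X i.

HB.instance Definition _ := gen_eqMixin (metric_prod X_le1 E).
HB.instance Definition _ := gen_choiceMixin (metric_prod X_le1 E).
HB.instance Definition _ := @isMetric.Build R (metric_prod X_le1 E)
  prod_mdist prod_mdistxx prod_mdist_positivity prod_mdist_sym
  prod_mdist_triangle.

End product_metric.

(* Main.v *)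
Require Import Defs.
From mathcomp Require Import all_boot all_order all_algebra.
From mathcomp Require Import all_classical all_reals all_analysis.
From mathcomp Require Import lra.

Import Order.TTheory GRing.Theory Num.Theory.
Import numFieldNormedType.Exports.

Local Open Scope classical_set_scope.
Local Open Scope ring_scope.

(** A straight space cannot be cut badly: if P and Q are disjoint open sets,
    then points a of P and b of Q cannot come arbitrarily close while a keeps a
    fixed distance from the complement of P and Q
    ([straight_open_disjoint]).  Otherwise the truncated distance to that
    complement, kept on P and replaced by 0 elsewhere, would be continuous and
    uniformly continuous on the two closed sets ~P and ~Q, which cover the
    space, but not on their union.

    Now let the product Z be straight and suppose that some factor X_j is not
    totally bounded; it contains a sequence z_n that is uniformly discrete.
    Suppose also that, inside every slice x_j = y, there are arbitrarily close
    pairs a, b which two disjoint open sets separate throughout a ball of fixed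
    radius around a.  Taking such a pair over each z_n with distance tending to
    0, and cutting the separating sets down to disjoint tubes around the slices
    x_j = z_n, the unions over n contradict the above
    ([straight_split_totally_bounded]).

    There are two sources of such pairs.  If another factor X_i is not ULC, then
    it contains arbitrarily close points in distinct quasicomponents of a ball
    of fixed radius ([unif_locally_connected_split]): were close points always
    in the same quasicomponent, quasicomponents of balls would be open, hence
    connected, and would witness ULC.  If infinitely many factors are
    disconnected, then points differing in a single coordinate of large rank are
    close, although a clopen set of that factor separates them.  So when X_j is
    not totally bounded all other factors are ULC and almost all are connected.
    The trichotomy follows: if X_j is ULC this is (a); if not, exchanging the
    roles of X_j and X_i shows that every other X_i is totally bounded, which is
    (c).

    Each factor is a uniform retract of the product, so it inherits
    straightness and ULC.  The characterization of ULC products rests on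
    products of connected sets being connected ([box_connected]).  About the
    product metric only one thing matters: it induces the product uniformity
    ([mdist_coord_le], [prod_mdist_small]). *)

Set Implicit Arguments.
Unset Strict Implicit.
Unset Printing Implicit Defensive.

(** * Uniformities in terms of distances *)

Section uniform_preliminaries.
Context {R : realType}.
Implicit Types X Y : metricType R.

Lemma open_mdistP X (A : set X) :
  open A <->
  forall x, A x -> exists2 e, 0 < e & forall y, mdist x y < e -> A y.
Proof.
rewrite openE; split=> H x Ax.
  have /nbhs_ballP[e e0 eA] := H _ Ax.
  by exists e => // y xy; apply: eA; rewrite ballEmdist.
have [e e0 eA] := H _ Ax.
by apply/nbhs_ballP; exists e => // y; rewrite ballEmdist; exact: eA.
Qed.

Lemma unif_continuous_mdistP X Y (h : X -> Y) :
  unif_continuous h <->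
  forall e, 0 < e -> exists2 d, 0 < d &
    forall x y, mdist x y < d -> mdist (h x) (h y) < e.
Proof.
rewrite unif_continuousP; split=> H e e0; have [d d0 hd] := H e e0.
  exists d => // x y xy; have := hd (x, y).
  by rewrite !ballEmdist; exact.
by exists d => // -[x y]; rewrite !ballEmdist; exact: hd.
Qed.

Lemma unif_continuous_realP X (f : X -> R) :
  unif_continuous f <->
  forall e, 0 < e -> exists2 d, 0 < d &
    forall x y, mdist x y < d -> `|f x - f y| < e.
Proof.
rewrite unif_continuousP; split=> H e e0; have [d d0 hd] := H e e0.
  exists d => // x y xy; have := hd (x, y).
  by rewrite ballEmdist; exact.
by exists d => // -[x y]; rewrite ballEmdist; exact: hd.
Qed.

(** Points outside A only see themselves in the uniformity of the subspace, so
    they impose no condition on f. *)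
Lemma unif_continuous_onP X (A : set X) (f : X -> R) :
  unif_continuous_on A f <->
  forall e, 0 < e -> exists2 d, 0 < d &
    forall x y, A x -> A y -> mdist x y < d -> `|f x - f y| < e.
Proof.
rewrite /unif_continuous_on unif_continuousP; split=> H e e0;
  have [d d0 hd] := H e e0; exists d => //.
  move=> x y Ax Ay xy; apply: (hd (x, y)) => /=.
  by rewrite ball_subspace_ball /subspace_ball mem_set// ballEmdist.
move=> [x y]/=; rewrite ball_subspace_ball /subspace_ball.
case: ifPn => [/set_mem Ax|_ ->]; last exact: ballxx.
by rewrite ballEmdist => -[Ay xy]; exact: hd.
Qed.

Lemma unif_continuous_continuous X Y (h : X -> Y) :
  unif_continuous h -> continuous h.
Proof.
move=> /unif_continuous_mdistP hu x; apply/cvg_ballP => e e0.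
have [d d0 hd] := hu e e0; apply/nbhs_ballP; exists d => // y.
by rewrite !ballEmdist; exact: hd.
Qed.

Lemma real_continuous_mdist X (f : X -> R) :
  (forall x e, 0 < e ->
     exists2 d, 0 < d & forall y, mdist x y < d -> `|f x - f y| < e) ->
  continuous f.
Proof.
move=> H x; apply/cvg_ballP => e e0; have [d d0 fd] := H x e e0.
by apply/nbhs_ballP; exists d => // y; rewrite ballEmdist; exact: fd.
Qed.

End uniform_preliminaries.

(** * Disjoint open sets in a straight space *)

Section straight_separation.
Context {R : realType} {X : metricType R}.
Implicit Types (P Q D : set X) (e : R).

(** The distance from x to D truncated at e; the truncation makes it
    meaningful for empty D as well. *)
Definition trunc_dist e D (x : X) : R :=
  inf (e |` [set mdist x z | z in D]).

Section trunc_dist_lemmas.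
Variables (e : R) (D : set X).
Hypothesis e_ge0 : 0 <= e.

Let values (x : X) : set R := e |` [set mdist x z | z in D].

Let lb_values x : lbound (values x) 0.
Proof. by move=> _ [->//|[z _ <-]]; exact: mdist_ge0. Qed.

Let has_inf_values x : has_inf (values x).
Proof. by split; [exists e; left|exists 0; exact: lb_values]. Qed.

Let trunc_dist_le x r : values x r -> trunc_dist e D x <= r.
Proof. by apply: ge_inf; have [] := has_inf_values x. Qed.

Lemma trunc_dist_ge0 x : 0 <= trunc_dist e D x.
Proof.
by apply: lb_le_inf; [have [] := has_inf_values x|exact: lb_values].
Qed.

Lemma trunc_dist_eq0 x : D x -> trunc_dist e D x = 0.
Proof.
move=> Dx; apply/eqP; rewrite eq_le trunc_dist_ge0 andbT.
by apply: trunc_dist_le; right; exists x => //; rewrite mdistxx.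
Qed.

Lemma trunc_dist_far x : (forall z, mdist x z < e -> ~ D z) ->
  trunc_dist e D x = e.
Proof.
move=> xD; apply/eqP; rewrite eq_le trunc_dist_le/=; last by left.
apply: lb_le_inf; first by have [] := has_inf_values x.
by move=> _ [->//|[z Dz <-]]; rewrite leNgt; apply/negP => /xD.
Qed.

Lemma trunc_dist_lip x y :
  `|trunc_dist e D x - trunc_dist e D y| <= mdist x y.
Proof.
suff H u v : trunc_dist e D u - mdist u v <= trunc_dist e D v.
  move: (H x y) (H y x); rewrite (metric_sym y) ler_norml => ? ?.
  by apply/andP; split; lra.
apply: lb_le_inf; first by have [] := has_inf_values v.
move=> _ [->|[z Dz <-]]; rewrite lerBlDr.
  by rewrite ler_wpDr ?mdist_ge0//; apply: trunc_dist_le; left.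
apply: (@le_trans _ _ (mdist u z)).
  by apply: trunc_dist_le; right; exists z.
by rewrite addrC metric_triangle.
Qed.

End trunc_dist_lemmas.

(** The test function f is the truncated distance to the complement of P and Q
    on P, and 0 elsewhere.  It is 1-Lipschitz along any pair of points that does
    not join P to Q.  This covers the pairs inside ~P, those inside ~Q, and
    those formed by a given point and any point near it, hence continuity; but f
    drops from e to 0 between a and b. *)
Lemma straight_open_disjoint P Q e : straight X -> 0 < e ->
  open P -> open Q -> P `&` Q = set0 ->
  exists2 d, 0 < d & forall a b, P a -> Q b ->
    ball a e `<=` P `|` Q -> d <= mdist a b.
Proof.
move=> sX e0 oP oQ PQ0.
have notPQ x : P x -> Q x -> False.
  by move=> Px Qx; suff : set0 x by []; rewrite -PQ0.
pose g := trunc_dist e (~` (P `|` Q)).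
pose f x := if x \in P then g x else 0.
have e_ge0 := ltW e0.
have f_out x : ~ P x -> f x = 0 by rewrite /f; case: ifPn => // /set_mem.
have f_in x : ~ Q x -> f x = g x.
  move=> Qx; rewrite /f; case: ifPn => // /negP Px.
  by rewrite /g trunc_dist_eq0// => -[/mem_set|].
have f_lip x y : ~ (P x /\ Q y) -> ~ (Q x /\ P y) -> `|f x - f y| <= mdist x y.
  move=> nPQ nQP.
  have [nQ|nP] : (~ Q x /\ ~ Q y) \/ (~ P x /\ ~ P y).
    have [Qx|nQx] := pselect (Q x).
      by right; split=> [/notPQ|Py]; [exact|exact: nQP].
    have [Qy|nQy] := pselect (Q y); last by left.
    by right; split=> [Px|/notPQ]; [exact: nPQ|exact].
  - by rewrite !f_in; [exact: trunc_dist_lip|case: nQ..].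
  - by rewrite !f_out; [rewrite subrr normr0 mdist_ge0|case: nP..].
have cf : continuous f.
  apply: real_continuous_mdist => x r r0.
  have [Px|nPx] := pselect (P x).
    have [d d0 dP] := (iffLR (open_mdistP P) oP) x Px.
    exists (Num.min r d) => [|y]; rewrite lt_min ?r0// => /andP[xyr /dP Py].
    apply: le_lt_trans xyr; apply: f_lip => -[].
      by move=> _ /(notPQ _ Py).
    by move=> /(notPQ _ Px).
  have [Qx|nQx] := pselect (Q x).
    have [d d0 dQ] := (iffLR (open_mdistP Q) oQ) x Qx.
    exists (Num.min r d) => [|y]; rewrite lt_min ?r0// => /andP[xyr /dQ Qy].
    apply: le_lt_trans xyr; apply: f_lip => -[].
      by move=> /notPQ/(_ Qx).
    by move=> _ /notPQ/(_ Qy).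
  by exists r => // y; apply: le_lt_trans; apply: f_lip => -[].
pose C (k : 'I_2) := if k == ord0 then ~` Q else ~` P.
have closedC k : closed (C k).
  by rewrite /C; case: ifP => _; exact: open_closedC.
have coverC : \bigcup_k C k = setT.
  rewrite -subTset => x _; have [Px|nPx] := pselect (P x).
    by exists ord0 => //; exact: notPQ.
  by exists ord_max.
have /(iffRL (sX _ _ closedC coverC f cf)) :
    forall k, unif_continuous_on (C k) f.
  move=> k; apply/unif_continuous_onP => r r0; exists r => // x y.
  rewrite /C; case: ifP => _ Cx Cy; apply: le_lt_trans;
    by apply: f_lip => -[].
move=> /unif_continuous_realP/(_ e e0)[d d0 fd].
exists d => // a b Pa Qb aPQ; rewrite leNgt; apply/negP => /fd.
rewrite f_in; last exact: notPQ.
rewrite (f_out b) ?subr0; last by move/notPQ; exact.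
rewrite /g trunc_dist_far ?ger0_norm ?ltxx// => z az nz.
by apply/nz/aPQ; rewrite ballEmdist.
Qed.

End straight_separation.

(** * Failure of total boundedness *)

Section total_boundedness.
Context {R : realType}.

Lemma not_totally_bounded_discrete (Y : metricType R) :
  ~ totally_bounded Y ->
  exists2 r, 0 < r & exists z : nat -> Y,
    forall m n, (m < n)%N -> r <= mdist (z m) (z n).
Proof.
move=> /existsNP[r /not_implyP[r0 notTB]]; exists r => //.
have /choice[f fP] (s : seq Y) : exists y, forall x, x \in s -> r <= mdist x y.
  apply: contrapT => /forallNP far; apply: notTB; exists [set` s] => //.
  apply/esym; rewrite -subTset => y _; have := far y.
  move=> /existsNP[x /not_implyP[xs /negP]]; rewrite -ltNge => xy.
  by exists x => //; rewrite ballEmdist.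
(* greedy choice: the next point is far from all the previous ones *)
pose s n := iter n (fun s => f s :: s) [::].
exists (f \o s) => m n mn; apply: fP.
elim: n mn => // n IHn; rewrite ltnS leq_eqVlt in_cons => /predU1P[->|/IHn ->].
  by rewrite eqxx.
by rewrite orbT.
Qed.

End total_boundedness.

(** * Quasicomponents and uniform local connectedness *)

(** For a and b in an open set U: they lie in distinct quasicomponents of U.
    Having P and Q open in the whole space, possibly larger than U, makes the
    notion stable under preimages and under shrinking U. *)
Definition split_in (X : topologicalType) (U : set X) (a b : X) : Prop :=
  exists P Q : set X,
    [/\ open P, open Q, P `&` Q = set0, P a /\ Q b & U `<=` P `|` Q].

Lemma split_in_preimage (Z X : topologicalType) (h : Z -> X) (U : set X) a b :
  continuous h -> split_in U (h a) (h b) -> split_in (h @^-1` U) a b.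
Proof.
move=> /continuousP ch [P [Q [oP oQ PQ0 [Pa Qb] PQ]]].
exists (h @^-1` P), (h @^-1` Q); split => //; [exact: ch|exact: ch| |].
  by rewrite -preimage_setI PQ0 preimage_set0.
by move=> c; exact: PQ.
Qed.

Lemma split_inS (X : topologicalType) (U V : set X) a b :
  U `<=` V -> split_in V a b -> split_in U a b.
Proof.
move=> UV [P [Q [oP oQ PQ0 Pab PQ]]].
by exists P, Q; split => //; exact: subset_trans UV PQ.
Qed.

Lemma not_connected_split (X : topologicalType) :
  ~ connected [set: X] -> exists x y : X, split_in setT x y.
Proof.
move=> /connectedPn[E [E0 EU sE]].
have [x Ex] := E0 false; have [y Ey] := E0 true.
have oE b : open (E b).
  have -> : E b = ~` closure (E (~~ b)).
    apply/seteqP; split=> z.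
      move=> Ebz cz; case: sE; case: b Ebz cz => /= ? ? E1 E2.
        by suff : set0 z by []; rewrite -E1.
      by suff : set0 z by []; rewrite -E2.
    move=> cz; have : [set: X] z by []; rewrite EU.
    by case: b cz => /= cz [|]// /subset_closure /cz.
  exact/closed_openC/closed_closure.
exists x, y, (E false), (E true); split => //.
  exact: separated_disjoint.
by rewrite -EU.
Qed.

Section quasicomponents.
Context {R : realType}.

Section diameter.
Context {X : metricType R}.
Implicit Types (A : set X) (e r : R).

Lemma diameter_lt A r e : (forall x y, A x -> A y -> mdist x y <= r) ->
  r < e -> (diameter A < e%:E)%E.
Proof.
move=> Ar re; apply: (@le_lt_trans _ _ r%:E); last by rewrite lte_fin.
by apply: ge_ereal_sup => _ [x Ax [y Ay <-]]; rewrite lee_fin Ar.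
Qed.

Lemma mdist_lt_diameter A e x y : (diameter A < e%:E)%E -> A x -> A y ->
  mdist x y < e.
Proof.
move=> Ae Ax Ay; rewrite -lte_fin; apply: le_lt_trans Ae.
by apply: ereal_sup_ubound; exists x => //; exists y.
Qed.

End diameter.

(** The quasicomponent C of x in U = ball x r is open, since around any of its
    points a small ball inside U has the property assumed at a smaller scale.
    Being clopen in U, C admits no further clopen cut, so it is connected. *)
Lemma unif_locally_connected_split (X : metricType R) :
  (forall e, 0 < e -> exists2 d, 0 < d &
     forall x y : X, mdist x y < d -> ~ split_in (ball x e) x y) ->
  unif_locally_connected X.
Proof.
move=> H e e0; pose r := e / 3.
have r0 : 0 < r by rewrite divr_gt0.
have [d d0 hd] := H r r0; exists (Num.min r d); first by rewrite lt_min r0.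
move=> x y; rewrite lt_min => /andP[xyr /hd nxy].
pose U := [set z | mdist x z < r].
have oU : open U.
  apply/open_mdistP => z Uz; exists (r - mdist x z); first by rewrite subr_gt0.
  move=> t zt; apply: le_lt_trans (metric_triangle _ z _) _.
  by rewrite -ltrBrDl.
pose C := [set z | U z /\ ~ split_in (ball x r) x z].
have oC : open C.
  apply/open_mdistP => z [Uz Cz].
  have [s s0 sU] := iffLR (open_mdistP U) oU z Uz.
  have [t t0 ht] := H s s0.
  exists (Num.min s t) => [|w]; rewrite lt_min ?s0// => /andP[/sU Uw /ht nzw].
  split => // -[P [Q [oP oQ PQ0 [Px Qw] PQ]]].
  have [Pz|Qz] : (P `|` Q) z by apply: PQ; rewrite ballEmdist.
    apply: nzw; exists P, Q; split => // c.
    by rewrite ballEmdist => /sU Uc; apply: PQ; rewrite ballEmdist.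
  by apply: Cz; exists P, Q.
have oUC : open (U `\` C).
  apply/open_mdistP => z [Uz /not_andP[//|/contrapT[P [Q]]]].
  move=> [oP oQ PQ0 [Px Qz] PQ].
  have [s s0 sUQ] := iffLR (open_mdistP _) (openI oU oQ) z (conj Uz Qz).
  exists s => // w /sUQ[Uw Qw]; split => // -[_]; apply.
  by exists P, Q.
have Cx : C x.
  split; first by rewrite /U/= mdistxx.
  move=> [P [Q [_ _ PQ0 [Px Qx] _]]].
  by suff : set0 x by []; rewrite -PQ0.
have Cy : C y by [].
exists C; split => //; last first.
  apply: (@diameter_lt _ _ (2 * r)); last by rewrite /r; lra.
  move=> u v [Uu _] [Uv _]; have := metric_triangle u x v.
  move: Uu Uv; rewrite /U/= (metric_sym u x)=> ? ?; lra.
(* A clopen part B of C is separated from the rest of U, so it cannot miss some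
   points of C and contain others. *)
move=> B [b Bb] [G oG BG] [F cF BF].
have oB : open B by rewrite BG; exact: openI.
have oB' : open ((C `\` B) `|` (U `\` C)).
  have -> : C `\` B = C `&` ~` F by rewrite BF setDIr setDv set0U -setDE.
  by apply: openU => //; apply: openI => //; exact: closed_openC.
have BC : B `<=` C by rewrite BG => z [].
have PQ0 : B `&` ((C `\` B) `|` (U `\` C)) = set0.
  by apply/seteqP; split => // z [Bz [[_]|[_]]]; [exact|apply; exact: BC].
have UPQ : ball x r `<=` B `|` ((C `\` B) `|` (U `\` C)).
  rewrite ballEmdist => z Uz; have [Bz|nBz] := pselect (B z); first by left.
  by right; have [Cz|nCz] := pselect (C z); [left|right].
apply/seteqP; split => // c Cc; apply: contrapT => nBc.
have [Bx|nBx] := pselect (B x).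
  case: Cc (Cc) => _ + Cc; apply.
  by exists B, ((C `\` B) `|` (U `\` C)); split => //; split=> //; left.
case: (BC _ Bb) => _; apply.
exists ((C `\` B) `|` (U `\` C)), B; split => //.
- by rewrite setIC.
- by split=> //; left.
- by rewrite setUC.
Qed.

End quasicomponents.

(** * Straight spaces over a space that is not totally bounded *)

(** If Y contained a uniformly discrete sequence z_n, the preimages W_n of small
    balls around the z_n would be disjoint.  One close split pair over each z_n,
    with its separating sets cut down to W_n, would then give two disjoint open
    sets that no straight space can have. *)
Lemma straight_split_totally_bounded (R : realType) (Z Y : metricType R)
    (g : Z -> Y) (e : R) :
  straight Z -> unif_continuous g -> 0 < e ->
  (forall y (d : R), 0 < d -> exists a b,
     [/\ g a = y, g b = y, mdist a b < d & split_in (ball a e) a b]) ->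
  totally_bounded Y.
Proof.
move=> sZ gu e0 splitY; apply: contrapT.
move=> /not_totally_bounded_discrete[r r0 [z zr]].
have r20 : 0 < r / 2 by rewrite divr_gt0.
have [s s0 gs] := iffLR (unif_continuous_mdistP g) gu _ r20.
pose W n := g @^-1` [set y | mdist (z n) y < r / 2].
have oW n : open (W n).
  have /continuousP := unif_continuous_continuous gu; apply.
  apply/open_mdistP => y /= zy.
  exists (r / 2 - mdist (z n) y); first by rewrite subr_gt0.
  by move=> t yt; have := metric_triangle (z n) y t; lra.
have W_inj m n c : W m c -> W n c -> m = n.
  wlog mn : m n / (m < n)%N => [hw Wm Wn|].
    case: (ltngtP m n) => // mn; first exact: hw.
    by apply/esym; exact: hw.
  rewrite /W/= => Wm; rewrite metric_sym => Wn.
  exfalso; have := metric_triangle (z m) (g c) (z n).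
  by move: (zr _ _ mn) => {mn}; lra.
have /choice[ab abP] n : exists ab : Z * Z, [/\ g ab.1 = z n, g ab.2 = z n,
    mdist ab.1 ab.2 < n.+1%:R^-1 & split_in (ball ab.1 e) ab.1 ab.2].
  have n0 : 0 < n.+1%:R^-1 :> R by rewrite invr_gt0.
  by have [a [b H]] := splitY (z n) _ n0; exists (a, b).
have /choice[PQ PQP] n : exists PQ : set Z * set Z, [/\ open PQ.1, open PQ.2,
    PQ.1 `&` PQ.2 = set0, PQ.1 (ab n).1 /\ PQ.2 (ab n).2 &
    ball (ab n).1 e `<=` PQ.1 `|` PQ.2].
  by have [_ _ _ [P [Q H]]] := abP n; exists (P, Q).
pose P := \bigcup_n ((PQ n).1 `&` W n).
pose Q := \bigcup_n ((PQ n).2 `&` W n).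
have oP : open P.
  by apply: bigcup_open => n _; apply: openI => //; case: (PQP n).
have oQ : open Q.
  by apply: bigcup_open => n _; apply: openI => //; case: (PQP n).
have PQ0 : P `&` Q = set0.
  apply/seteqP; split => // c [[m _ [Pc Wm]] [n _ [Qc Wn]]].
  have mn := W_inj _ _ _ Wm Wn; rewrite {}mn in Pc.
  by case: (PQP n) => _ _ <-.
have es0 : 0 < Num.min e s by rewrite lt_min e0.
have [d d0 dP] := straight_open_disjoint sZ es0 oP oQ PQ0.
have [n nd] : exists n, n.+1%:R^-1 < d.
  exists (Num.truncn d^-1); rewrite -[ltRHS]invrK ltf_pV2 ?posrE ?invr_gt0//.
  exact: truncnS_gt.
have [ga gb abn _] := abP n; have [_ _ _ [Pa Qb] abPQ] := PQP n.
have Wn c : g c = z n -> W n c by move=> gc; rewrite /W/= gc mdistxx.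
have := lt_trans abn nd; rewrite ltNge => /negP; apply; apply: dP.
- by exists n => //; split=> //; exact: Wn.
- by exists n => //; split=> //; exact: Wn.
- move=> c; rewrite ballEmdist/= lt_min => /andP[ace /gs]; rewrite ga => Wc.
  have [Pc|Qc] : ((PQ n).1 `|` (PQ n).2) c by apply: abPQ; rewrite ballEmdist.
    by left; exists n.
  by right; exists n.
Qed.

(** * The product metric induces the product uniformity *)

Section product_uniformity.
Context {R : realType} {I : Type} {X : I -> metricType R}.
Hypothesis X_le1 : forall i (x y : X i), mdist x y <= 1.
Implicit Types (x y : forall i, X i) (u : R^nat).

(** Summation by induction of the geometric tail c / 2^(N+1) + c / 2^(N+2) + ...
    up to c / 2^(N+k). *)
Lemma series_halves_le u (N k : nat) (c : R) :
  (forall n, (N <= n < N + k)%N -> u n <= (2 ^+ n.+1)^-1 * c) ->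
  series u (N + k)%N <= series u N + c * ((2 ^+ N)^-1 - (2 ^+ (N + k))^-1).
Proof.
elim: k => [|k IHk] uc; first by rewrite addn0 subrr mulr0 addr0.
have /IHk : forall n, (N <= n < N + k)%N -> u n <= (2 ^+ n.+1)^-1 * c.
  by move=> n /andP[Nn nk]; rewrite uc// Nn addnS ltnW.
have := uc (N + k)%N; rewrite leq_addr addnS ltnSn => /(_ isT).
rewrite /series/= big_nat_recr//= exprS invfM.
by lra.
Qed.

Lemma series_halves_le0 u k c : 0 <= c ->
  (forall n, (n < k)%N -> u n <= (2 ^+ n.+1)^-1 * c) -> series u k <= c.
Proof.
move=> c0 uc; have := @series_halves_le u 0 k c.
rewrite add0n => /(_ uc)/le_trans; apply.
rewrite /series/= big_geq// add0r ler_piMr// invr1 lerBlDr lerDl.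
by rewrite invr_ge0 exprn_ge0.
Qed.

Let term (e : nat -> I) x y n : R := (2 ^+ n.+1)^-1 * mdist (x (e n)) (y (e n)).

Let term_ge0 e x y n : 0 <= term e x y n.
Proof. by rewrite mulr_ge0 ?mdist_ge0// invr_ge0 exprn_ge0. Qed.

Let term_nondecreasing e x y : nondecreasing_seq (series (term e x y)).
Proof. by apply: nondecreasing_series => n _ _; exact: term_ge0. Qed.

Let term_cvg e x y : cvgn (series (term e x y)).
Proof.
apply: nondecreasing_is_cvgn; first exact: term_nondecreasing.
exists 1 => _ [n _ <-]; apply: series_halves_le0 => // m _.
by rewrite ler_wpM2l// invr_ge0 exprn_ge0.
Qed.

Lemma mdist_coord_le (E : enumeration I) (i : I) :
  exists2 K : R, 0 < K &
    forall x y, mdist (x i) (y i) <= K * prod_mdist E x y.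
Proof.
rewrite /prod_mdist; case: E => [n e|e] [g ge eg].
  exists 1 => // x y; rewrite mul1r (bigD1 (g i))//= eg lerDl sumr_ge0// => k _.
  exact: mdist_ge0.
have K0 : 0 < 2 ^+ (g i).+1 :> R by rewrite exprn_gt0.
exists (2 ^+ (g i).+1) => // x y.
rewrite -ler_pdivrMl//.
have := nondecreasing_cvgn_le (@term_nondecreasing e x y) (@term_cvg e x y).
move=> /(_ (g i).+1); apply: le_trans.
rewrite /series/= big_nat_recr//= {2}/term eg lerDr.
by apply: sumr_ge0 => k _; exact: term_ge0.
Qed.

(** The rank of a factor is its position in the enumeration.  The factors of
    rank at least N contribute at most 2^-N in the infinite case, and there are
    none with N = n in the case of n factors; the remaining distances, when at
    most d, contribute at most d respectively nd. *)
Lemma prod_mdist_small (E : enumeration I) :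
  exists2 rank : I -> nat, injective rank &
    forall e : R, 0 < e -> exists N, exists2 d, 0 < d &
      forall x y, (forall i, (rank i < N)%N -> mdist (x i) (y i) < d) ->
        prod_mdist E x y < e.
Proof.
rewrite /prod_mdist; case: E => [n e|e] [g ge eg].
  exists (fun i => g i) => [i j /val_inj/(can_inj eg)//|r r0].
  exists n, (r / n.+1%:R) => [|x y xy]; first by rewrite divr_gt0.
  apply: (@le_lt_trans _ _ (\sum_(k < n) r / n.+1%:R)).
    by apply: ler_sum => k _; apply/ltW/xy.
  rewrite sumr_const card_ord -[ltLHS]mulr_natr mulrAC -mulrA gtr_pMr//.
  by rewrite ltr_pdivrMr// mul1r ltr_nat.
exists g => [|r r0]; first exact: can_inj eg.
have r30 : 0 < r / 3 by rewrite divr_gt0.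
have [N Nr] : exists N, (2 ^+ N)^-1 < r / 3.
  exists (Num.truncn (r / 3)^-1); rewrite -[ltRHS]invrK.
  rewrite ltf_pV2 ?posrE ?invr_gt0 ?exprn_gt0//.
  apply: lt_le_trans (truncnS_gt _) _.
  by rewrite -natrX ler_nat ltn_expl.
exists N, (r / 3) => // x y xy.
have u_le n : (n < N)%N -> mdist (x (e n)) (y (e n)) <= r / 3.
  by move=> nN; apply/ltW/xy; rewrite ge.
suff : limn (series (term e x y)) <= 2 * (r / 3) by rewrite /term; lra.
apply: limr_le; first exact: term_cvg.
near=> m; have Nm : (N <= m)%N by near: m; exact: nbhs_infty_ge.
rewrite -(subnKC Nm).
have H1 : series (term e x y) N <= r / 3.
  apply: series_halves_le0 => [|n nN]; first exact: ltW.
  by rewrite ler_wpM2l ?invr_ge0 ?exprn_ge0// u_le.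
have := @series_halves_le (term e x y) N (m - N) 1.
move=> /(_ _)/le_trans; apply.
  by move=> n _; rewrite ler_wpM2l// invr_ge0 exprn_ge0.
have : 0 <= (2 ^+ (N + (m - N)))^-1 :> R by rewrite invr_ge0 exprn_ge0.
lra.
Unshelve. all: by end_near. Qed.

End product_uniformity.

(** * Uniform retracts *)

Section uniform_retracts.
Context {R : realType} {Z Y : metricType R} {h : Z -> Y} {s : Y -> Z}.
Hypotheses (h_uc : unif_continuous h) (s_uc : unif_continuous s).
Hypothesis sK : cancel s h.

Lemma straight_retract : straight Z -> straight Y.
Proof.
move=> sZ n C closedC coverC f cf; split=> [|fC].
  move=> /unif_continuous_realP fu k; apply/unif_continuous_onP => e e0.
  by have [d d0 fd] := fu e e0; exists d => // x y _ _; exact: fd.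
have ch := unif_continuous_continuous h_uc.
have hZ : unif_continuous (f \o h).
  apply/(sZ n (fun k => h @^-1` C k)).
  - by move=> k; apply: closed_comp => // z _; exact: ch.
  - by rewrite -preimage_bigcup coverC preimage_setT.
  - by move=> z; apply: continuous_comp; [exact: ch|exact: cf].
  move=> k; apply/unif_continuous_onP => e e0.
  have [d d0 fd] := iffLR (unif_continuous_onP _ _) (fC k) e e0.
  have [d' d'0 hd] := iffLR (unif_continuous_mdistP _) h_uc d d0.
  by exists d' => // x y Cx Cy /hd; exact: fd.
apply/unif_continuous_realP => e e0.
have [d d0 fd] := iffLR (unif_continuous_realP _) hZ e e0.
have [d' d'0 sd] := iffLR (unif_continuous_mdistP _) s_uc d d0.
by exists d' => // x y /sd/fd; rewrite /= !sK.
Qed.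

Lemma unif_locally_connected_retract :
  unif_locally_connected Z -> unif_locally_connected Y.
Proof.
move=> ulcZ e e0; have e20 : 0 < e / 2 by rewrite divr_gt0.
have [r r0 hr] := iffLR (unif_continuous_mdistP _) h_uc _ e20.
have [d d0 ulc] := ulcZ r r0.
have [d' d'0 sd] := iffLR (unif_continuous_mdistP _) s_uc d d0.
exists d' => // x y /sd/ulc[C [cC Cx Cy Cr]].
exists (h @` C); split.
- apply: connected_continuous_connected => //.
  exact/continuous_subspaceT/unif_continuous_continuous.
- by exists (s x).
- by exists (s y).
apply: (@diameter_lt _ _ _ (e / 2)); last by lra.
by move=> _ _ [u Cu <-] [v Cv <-]; apply/ltW/hr/(mdist_lt_diameter Cr).
Qed.

End uniform_retracts.

(** * Coordinates and boxes in the product *)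

Lemma almost_all_by_rank (I : Type) (P : I -> Prop) (rank : I -> nat) N :
  injective rank -> (forall i, (N <= rank i)%N -> P i) ->
  finite_set [set i | ~ P i].
Proof.
move=> rank_inj NP; apply: (@sub_finite_set _ _ (rank @^-1` `I_N)).
  by move=> i /= nPi; rewrite ltnNge; apply/negP => /NP.
apply: finite_preimage; last exact: finite_II.
by move=> i j _ _; exact: rank_inj.
Qed.

Section product.
Context {R : realType} {I : Type} (E : enumeration I) {X : I -> metricType R}.
Variable X_le1 : forall i (x y : X i), mdist x y <= 1.
Notation Z := (metric_prod X_le1 E).

Definition coord (i : I) (x : Z) : X i := x i.

Definition update (x : Z) (i : I) (v : X i) : Z :=
  @dfwith {classic I} X x i v.

Lemma update_in x i v : coord i (update x v) = v.
Proof. exact: (@dfwithin {classic I} X). Qed.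

Lemma update_out x i (v : X i) j : i <> j -> coord j (update x v) = coord j x.
Proof. by move=> ij; apply: (@dfwithout {classic I} X); exact/eqP. Qed.

Lemma coord_inj x y : (forall i, coord i x = coord i y) -> x = y.
Proof. exact: functional_extensionality_dep. Qed.

Lemma coord_unif_continuous i : unif_continuous (coord i).
Proof.
apply/unif_continuous_mdistP => e e0.
have [K K0 HK] := @mdist_coord_le _ _ _ X_le1 E i.
exists (e / K) => [|x y]; first by rewrite divr_gt0.
by rewrite ltr_pdivlMr// mulrC; exact: le_lt_trans (HK x y).
Qed.

Arguments coord_unif_continuous : clear implicits.

Lemma coord_continuous i : continuous (coord i).
Proof. exact/unif_continuous_continuous/coord_unif_continuous. Qed.

Lemma metric_prod_small :
  exists2 rank : I -> nat, injective rank &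
    forall e : R, 0 < e -> exists N, exists2 d, 0 < d &
      forall x y : Z,
        (forall i, (rank i < N)%N -> mdist (coord i x) (coord i y) < d) ->
        mdist x y < e.
Proof. exact: prod_mdist_small. Qed.

Lemma update_unif_continuous x i :
  unif_continuous (fun v : X i => update x v).
Proof.
have [rank _ small] := metric_prod_small.
apply/unif_continuous_mdistP => e e0; have [N [d d0 Nd]] := small e e0.
exists d => // v w vw; apply: Nd => j _.
have [ij|ij] := pselect (i = j); last by rewrite !update_out// mdistxx.
by case: _ / ij; rewrite !update_in.
Qed.

Arguments update_unif_continuous : clear implicits.

(** A relatively clopen part B of the box with a point p is stable under
    changing one coordinate within the box, because such changes form a
    connected slice.  Starting from p one thus reaches in B points agreeing
    with any given x of the box on the coordinates of rank below n; they
    converge to x, and B is relatively closed. *)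
Lemma box_connected (C : forall i, set (X i)) :
  (forall i, connected (C i)) ->
  connected [set x : Z | forall i, C i (coord i x)].
Proof.
move=> cC; set A := [set x | _]; move=> B [p Bp] [G oG BG] [F cF BF].
have BA : B `<=` A by rewrite BG => x [].
have B_update x i v : B x -> C i v -> B (update x v).
  move=> Bx Cv; pose S := (fun w : X i => update x w) @` C i.
  have SA : S `<=` A.
    move=> _ [w Cw <-] j; have [ij|ij] := pselect (i = j).
      by case: _ / ij; rewrite update_in.
    by rewrite update_out//; exact: (BA x Bx).
  have cS : connected S.
    apply: connected_continuous_connected => //.
    apply/continuous_subspaceT/unif_continuous_continuous.
    exact: update_unif_continuous.
  suff SB : S `&` B = S.
    by have [] : (S `&` B) (update x v) by rewrite SB; exists v.
  apply: cS.
  - exists x; split => //; exists (coord i x); first exact: (BA x Bx).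
    apply: coord_inj => j; have [ij|ij] := pselect (i = j).
      by case: _ / ij; rewrite update_in.
    by rewrite update_out.
  - by exists G => //; rewrite BG setIA (setIidl SA).
  - by exists F => //; rewrite BF setIA (setIidl SA).
have [rank rank_inj small] := metric_prod_small.
apply/seteqP; split => // x Ax.
pose splice n : Z := fun i => if (rank i < n)%N then coord i x else coord i p.
have Bsplice n : B (splice n).
  elim: n => [//|n IHn].
  have [[i ri]|nri] := pselect (exists i, rank i = n).
    have -> : splice n.+1 = update (splice n) (coord i x).
      apply: coord_inj => j; have [ij|ij] := pselect (i = j).
        by case: _ / ij; rewrite update_in /coord/splice ri ltnSn.
      rewrite update_out// /coord/splice ltnS leq_eqVlt.
      by case: eqP => //= rj; case: ij; apply: rank_inj; rewrite ri.
    by apply: B_update => //; exact: Ax.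
  suff -> : splice n.+1 = splice n by [].
  apply: coord_inj => j; rewrite /coord/splice ltnS leq_eqVlt.
  by case: eqP => //= rj; case: nri; exists j.
rewrite BF; split => //; apply: contrapT => nFx.
have [e e0 eF] := iffLR (open_mdistP _) (closed_openC cF) x nFx.
have [N [d d0 Nd]] := small e e0.
apply: (eF (splice N)); last by have := Bsplice N; rewrite BF => -[].
by apply: Nd => i iN; rewrite /coord/splice iN mdistxx.
Qed.

(** * Local connectedness of the product and of its factors *)

Hypothesis X_nonempty : forall i, [set: X i] !=set0.

Let base : Z := fun i => sval (cid (X_nonempty i)).

Lemma straight_factor i : straight Z -> straight (X i).
Proof.
have updateK : cancel (fun v : X i => update base v) (coord i).
  by move=> v; rewrite update_in.
exact: (straight_retract (coord_unif_continuous i)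
  (update_unif_continuous base i) updateK).
Qed.

Lemma unif_locally_connected_factor i :
  unif_locally_connected Z -> unif_locally_connected (X i).
Proof.
have updateK : cancel (fun v : X i => update base v) (coord i).
  by move=> v; rewrite update_in.
exact: (unif_locally_connected_retract (coord_unif_continuous i)
  (update_unif_continuous base i) updateK).
Qed.

(** Changing one coordinate of large rank moves a point by less than the modulus
    d for scale 1, so any two points of that factor lie in the projection of a
    connected set. *)
Lemma unif_locally_connected_almost_all :
  unif_locally_connected Z -> finite_set [set i | ~ connected [set: X i]].
Proof.
move=> /(_ 1 ltr01)[d d0 ulc]; have [rank rank_inj small] := metric_prod_small.
have [N [r r0 Nr]] := small d d0.
apply: (almost_all_by_rank rank_inj (N := N)) => i Ni.
have -> : [set: X i] =
    \bigcup_(C in [set C | connected C /\ C (coord i base)]) C.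
  apply/esym; rewrite -subTset => v _.
  have /ulc[C [cC Cb Cv _]] : mdist base (update base v) < d.
    apply: Nr => j jN; rewrite update_out ?mdistxx// => ij.
    by move: jN; rewrite -ij ltnNge Ni.
  exists (coord i @` C); last first.
    by exists (update base v) => //; rewrite update_in.
  split; last by exists base.
  apply: connected_continuous_connected => //.
  exact/continuous_subspaceT/coord_continuous.
by apply: bigcup_connected => [|C []//]; exists (coord i base) => C [].
Qed.

(** Close points x and y are joined by a box.  Its sides are small connected
    sets in finitely many coordinates, including those that matter for distances
    and those with a disconnected factor, and whole factors in the others. *)
Lemma metric_prod_unif_locally_connected :
  (forall i, unif_locally_connected (X i)) ->
  finite_set [set i | ~ connected [set: X i]] ->
  unif_locally_connected Z.
Proof.
move=> ulc fin e e0; have [rank rank_inj small] := metric_prod_small.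
have e20 : 0 < e / 2 by rewrite divr_gt0.
have [N [r r0 Nr]] := small _ e20.
have [M NM discM] : exists2 M, (N <= M)%N &
    forall i, ~ connected [set: X i] -> (rank i < M)%N.
  have /finite_seqP[s sE] := finite_image rank fin.
  exists (maxn N (\max_(k <- s) k).+1) => [|i ni]; first exact: leq_maxl.
  rewrite leq_max ltnS; apply/orP; right.
  have : (rank @` [set i | ~ connected [set: X i]]) (rank i) by exists i.
  by rewrite sE => /= ri; exact: leq_bigmax_seq.
have [d d0 hd] : exists2 d, 0 < d & forall x y : Z, mdist x y < d ->
    forall i, (rank i < M)%N -> exists C : set (X i),
      [/\ connected C, C (coord i x), C (coord i y) & (diameter C < r%:E)%E].
  elim: M {NM discM} => [|M [d d0 hd]]; first by exists 1.
  have [[i ri]|nri] := pselect (exists i, rank i = M); last first.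
    exists d => // x y /hd H i; rewrite ltnS leq_eqVlt => /predU1P[|/H//].
    by move=> ri; case: nri; exists i.
  have [s s0 hs] := ulc i r r0.
  have [t t0 ht] :=
    iffLR (unif_continuous_mdistP _) (coord_unif_continuous i) s s0.
  exists (Num.min d t); first by rewrite lt_min d0.
  move=> x y; rewrite lt_min => /andP[/hd H /ht/hs ulci] j.
  rewrite ltnS leq_eqVlt => /predU1P[|/H//].
  by rewrite -ri => /rank_inj ->.
exists d => // x y /hd H.
have box (i : I) : exists C : set (X i), [/\ connected C,
    C (coord i x), C (coord i y) & (rank i < N)%N -> (diameter C < r%:E)%E].
  have [iM|iM] := ltnP (rank i) M.
    by have [C [? ? ? ?]] := H i iM; exists C; split.
  exists setT; split => //.
    by apply: contrapT => /discM; rewrite ltnNge iM.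
  by move=> iN; have := leq_trans iN NM; rewrite ltnNge iM.
pose C i := sval (cid (box i)).
have HC i : [/\ connected (C i), C i (coord i x), C i (coord i y) &
    (rank i < N)%N -> (diameter (C i) < r%:E)%E] := svalP (cid (box i)).
exists [set z : Z | forall i, C i (coord i z)]; split.
- by apply: box_connected => i; have [] := HC i.
- by move=> i; have [] := HC i.
- by move=> i; have [] := HC i.
apply: (@diameter_lt _ _ _ (e / 2)); last by lra.
move=> u v Cu Cv; apply/ltW/Nr => i iN.
have [_ _ _ /(_ iN) Cr] := HC i.
exact: mdist_lt_diameter Cr (Cu i) (Cv i).
Qed.

(** * Factors next to one that is not totally bounded *)

Section not_totally_bounded_factor.
Variable j : I.
Hypotheses (straightZ : straight Z) (j_unbounded : ~ totally_bounded (X j)).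

(** The pairs needed for [straight_split_totally_bounded] come from close points
    of X_i in distinct quasicomponents of a ball. *)
Lemma unif_locally_connected_other i : i <> j -> unif_locally_connected (X i).
Proof.
move=> ij; apply: unif_locally_connected_split => e e0.
apply: contrapT => split_close; apply: j_unbounded.
have [s s0 hs] :=
  iffLR (unif_continuous_mdistP _) (coord_unif_continuous i) e e0.
apply: (straight_split_totally_bounded straightZ (coord_unif_continuous j) s0).
move=> w d d0; have [b <-] : exists b : Z, coord j b = w.
  by exists (update base w); rewrite update_in.
have [t t0 ht] :=
  iffLR (unif_continuous_mdistP _) (update_unif_continuous b i) d d0.
have [v [v' [vv' split_vv']]] : exists v v' : X i,
    mdist v v' < t /\ split_in (ball v e) v v'.
  apply: contrapT => H; apply: split_close; exists t => // v v' vv' sp.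
  by apply: H; exists v, v'.
exists (update b v), (update b v'); split.
- by rewrite update_out.
- by rewrite update_out.
- exact: ht.
apply: (@split_inS _ _ (coord i @^-1` ball v e)).
  by move=> c; rewrite !ballEmdist => /hs; rewrite update_in.
by apply: split_in_preimage; [exact: coord_continuous|rewrite !update_in].
Qed.

(** Here the pairs differ in one coordinate of large rank, where they lie on the
    two sides of a clopen cut of the factor. *)
Lemma almost_all_connected_other :
  finite_set [set i | ~ connected [set: X i]].
Proof.
have [rank rank_inj small] := metric_prod_small.
apply: contrapT => inf_disc; apply: j_unbounded.
apply: (straight_split_totally_bounded straightZ (coord_unif_continuous j)
  ltr01).
move=> w d d0; have [N [r r0 Nr]] := small d d0.
have [i [ij Ni /not_connected_split[v [v' vv']]]] :
    exists i, [/\ i <> j, (N <= rank i)%N & ~ connected [set: X i]].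
  apply: contrapT => H; apply: inf_disc.
  apply: (almost_all_by_rank rank_inj (N := maxn N (rank j).+1)) => i.
  rewrite geq_max => /andP[Ni ji]; apply: contrapT => ni; apply: H.
  by exists i; split => // ij; move: ji; rewrite ij ltnn.
have [b <-] : exists b : Z, coord j b = w.
  by exists (update base w); rewrite update_in.
exists (update b v), (update b v'); split.
- by rewrite update_out.
- by rewrite update_out.
- apply: Nr => k kN; have ik : i <> k.
    by move=> ik; move: kN; rewrite -ik ltnNge Ni.
  by rewrite !update_out// mdistxx.
apply: (@split_inS _ _ (coord i @^-1` setT)) => //.
by apply: split_in_preimage; [exact: coord_continuous|rewrite !update_in].
Qed.

End not_totally_bounded_factor.

End product.

(** * Products that are straight *)

Theorem proposition6p7 (R : realType) (I : Type) (E : enumeration I)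
    (X : I -> metricType R)
    (X_le1 : forall i (x y : X i), mdist x y <= 1)
    (X_nonempty : forall i, [set: X i] !=set0) :
  straight (metric_prod X_le1 E) ->
  let almost_all_connected :=
    finite_set [set i | ~ connected [set: X i]] in
  [/\ (forall i, straight (X i)),
      [\/ (forall i, unif_locally_connected (X i)) /\ almost_all_connected,
          (forall i, totally_bounded (X i))
        | (exists i0, forall i, i <> i0 ->
             unif_locally_connected (X i) /\ totally_bounded (X i)) /\
          almost_all_connected]
    & ((forall i, unif_locally_connected (X i)) /\ almost_all_connected <->
       unif_locally_connected (metric_prod X_le1 E))].
Proof.
move=> sZ almost_all_connected; split.
- by move=> i; exact: straight_factor sZ.
- have [tb|/existsNP[j ntb]] := pselect (forall i, totally_bounded (X i)).
    exact: Or32.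
  have ulc := unif_locally_connected_other X_nonempty sZ ntb.
  have aac := almost_all_connected_other X_nonempty sZ ntb.
  have [ulcj|nulcj] := pselect (unif_locally_connected (X j)).
    apply: Or31; split => // i.
    by have [->|/ulc] := pselect (i = j).
  apply: Or33; split => //; exists j => i ij; split; first exact: ulc.
  (* now X_i plays the part of the factor that is not totally bounded *)
  apply: contrapT => ntbi; apply: nulcj.
  by apply: (unif_locally_connected_other X_nonempty sZ ntbi) => /esym.
- split=> [[ulc aac]|ulcZ].
    exact: metric_prod_unif_locally_connected.
  split; first by move=> i; exact: unif_locally_connected_factor ulcZ.
  exact: unif_locally_connected_almost_all ulcZ.
Qed.
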